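(* Consider the polynomial control system $\dot{\mathbf x}=\mathbf f(\mathbf x)+\mathbf g(\mathbf x)\mathbf u$ with polynomial $\mathbf f:\mathbb R^n\to\mathbb R^n$ and $\mathbf g:\mathbb R^n\to\mathbb R^{n\times m}$, and a non-negative polynomial cost $\Phi(\mathbf x,\mathbf u)$. Let $\epsilon>0$, and let $C_{i,SOS}$, $V_{i,SOS}$ ($i\ge 0$) and $\mathbf u_{i,SOS}$ ($i\ge 1$) be the sequences of constants, polynomials and polynomial vectors produced by the sequential procedure A-I described in the context. Suppose that the three series $$C_{SOS}=\sum_{i=0}^{\infty}\epsilon^iC_{i,SOS},\qquad \mathbf u_{SOS}(\mathbf x)=\sum_{i=1}^{\infty}\epsilon^i\mathbf u_{i,SOS}(\mathbf x),\qquad V_{SOS}(\mathbf x)=\sum_{i=0}^{\infty}\epsilon^iV_{i,SOS}(\mathbf x)$$ all converge (the last two for every $\mathbf x\in\mathbb R^n$). Apply the state-feedback controller $\mathbf u=\mathbf u_{SOS}(\mathbf x)$. If the trajectories of the closed-loop system $\dot{\mathbf x}=\mathbf f(\mathbf x)+\mathbf g(\mathbf x)\mathbf u_{SOS}(\mathbf x)$ are bounded, then $C_{SOS}$ is an upper bound of the long-time average cost, i.e. $\bar\Phi\le C_{SOS}$ along closed-loop trajectories.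
   Context: Long-time average cost: for a solution $\mathbf x(t)$ of the closed-loop system with feedback $\mathbf u(t)=\mathbf u(\mathbf x(t))$, $$\bar\Phi=\lim_{T\to\infty}\frac1T\int_0^T\Phi(\mathbf x(t),\mathbf u(t))\,dt ,$$ the limit being assumed to exist. SOS: a real polynomial $p(\mathbf x)$ is SOS (a sum of squares) if $p=\sum_{k} p_k^2$ for finitely many real polynomials $p_k$. Define $F(V,\mathbf u,C)=(\mathbf f(\mathbf x)+\mathbf g(\mathbf x)\mathbf u)\cdot\nabla_{\mathbf x}V+\Phi(\mathbf x,\mathbf u)-C$. Substituting $\mathbf u=\sum_{i\ge1}\epsilon^i\mathbf u_i(\mathbf x)$, $V=\sum_{i\ge0}\epsilon^iV_i(\mathbf x)$, $C=\sum_{i\ge0}\epsilon^iC_i$ and expanding in powers of $\epsilon$ gives $F=\sum_{i\ge0}\epsilon^iF_i$, where $$F_i(V_0,\dots,V_i,\mathbf u_1,\dots,\mathbf u_i,C_i)=\mathbf f\cdot\nabla_{\mathbf x}V_i+\sum_{j+l=i,\ j\ge1,\ l\ge 0}\mathbf g\mathbf u_j\cdot\nabla_{\mathbf x}V_l+\phi_i-C_i,$$ and $\phi_i$ is the coefficient of $\epsilon^i$ in the expansion of $\Phi(\mathbf x,\sum_{j\ge1}\epsilon^j\mathbf u_j(\mathbf x))$ in powers of $\epsilon$ (in particular $F_0=\mathbf f\cdot\nabla_{\mathbf x}V_0+\Phi(\mathbf x,0)-C_0$). The tunable functions $V_i$ are real polynomials of degree at most a fixed $d_V$ and the $\mathbf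 u_i$ are $\mathbb R^m$-valued polynomials of degree at most a fixed $d_{\mathbf u}$, with $d_V,d_{\mathbf u}$ independent of $i$. Procedure A-I: Step 0. Minimize $C_0$ over $C_0\in\mathbb R$ and $V_0$ subject to $-F_0(V_0,C_0)$ being SOS. Denote the optimal value by $C_{0,SOS}$ and an associated optimal $V_0$ by $V_{0,SOS}$. Step $i$ ($i=1,2,\dots$). Fix $V_j=V_{j,SOS}$ for $0\le j\le i-1$ and $\mathbf u_j=\mathbf u_{j,SOS}$ for $1\le j\le i-1$ as already found. Write $F_{j,SOS}=F_j(V_{0,SOS},\dots,V_{j,SOS},\mathbf u_{1,SOS},\dots,\mathbf u_{j,SOS},C_{j,SOS})$ for $j<i$. Minimize $C_i$ over $C_i\in\mathbb R$, $V_i$, $\mathbf u_i$ and polynomials $S_0,\dots,S_{i-1}$ subject to: $S_0,\dots,S_{i-1}$ are SOS, and $$-F_i(V_{0,SOS},\dots,V_{i-1,SOS},V_i,\mathbf u_{1,SOS},\dots,\mathbf u_{i-1,SOS},\mathbf u_i,C_i)+\sum_{j=0}^{i-1}S_j(\mathbf x)F_{j,SOS}(\mathbf x)\ \text{ is SOS}.$$ (The more conservative variant with all $S_j=0$ is also allowed.) Denote the optimal value by $C_{i,SOS}$ and associated optimal $V_i,\mathbf u_i$ by $V_{i,SOS},\mathbf u_{i,SOS}$. All these optima are assumed to exist and be attained. *)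

(* Defs.v *)
From HB Require Import structures.
From mathcomp Require Import all_boot all_order all_algebra.
From mathcomp Require Import all_classical all_reals all_analysis.
From mathcomp Require mpoly.
(* The notations of mpoly clash with those of MathComp-Analysis: below,
   [mpoly n R] is {mpoly R[n]}, [meval v p] is p.@[v], [mderiv i p] is the
   i-th partial derivative, [mmeasure mdeg p] is [msize p] (total degree + 1,
   and 0 for p = 0), [mpolyC n c] is c%:MP and [mpolyX R (mnm1 a)] is 'X_a. *)
Export -(notations) mpoly.

Set Implicit Arguments.
Unset Strict Implicit.
Unset Printing Implicit Defensive.
Import Order.TTheory GRing.Theory Num.Theory.
Import numFieldNormedType.Exports.

Local Open Scope classical_set_scope.
Local Open Scope ring_scope.

Definition is_sos (R : realType) (n : nat) (p : mpoly n R) : Prop :=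
  exists s : seq (mpoly n R), p = \sum_(q <- s) q ^+ 2.

Definition degree_le (R : realType) (n d : nat) (p : mpoly n R) : Prop :=
  (mmeasure mdeg p <= d.+1)%N.

Definition peval (R : realType) (n : nat) (p : mpoly n R) (x : 'cV[R]_n) : R :=
  meval (fun a => x a 0) p.

Definition mxpeval (R : realType) (n p q : nat) (A : 'M[mpoly n R]_(p, q))
    (x : 'cV[R]_n) : 'M[R]_(p, q) :=
  map_mx (fun r => peval r x) A.

Definition gradient (R : realType) (n : nat) (V : mpoly n R) :
    'cV[mpoly n R]_n :=
  \col_a mderiv a V.

Definition dot (R : realType) (n : nat) (v w : 'cV[mpoly n R]_n) : mpoly n R :=
  \sum_a v a 0 * w a 0.

(* The coefficient of eps^i in Phi(x, \sum_(j >= 1) eps^j u_j(x)), where the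
   first n variables of Phi are x and the last m are u.  The substitution takes
   place in R[x][eps], 'X being eps; terms with j > i do not contribute to the
   coefficient of eps^i, so the formal series is cut after j = i. *)
Definition phi_coef (R : realType) (n m : nat) (Phi : mpoly (n + m) R)
    (u : nat -> 'cV[mpoly n R]_m) (i : nat) : mpoly n R :=
  let xs : 'cV[{poly mpoly n R}]_n := \col_a (mpolyX R (mnm1 a))%:P in
  let us : 'cV[{poly mpoly n R}]_m :=
    \col_b \sum_(1 <= j < i.+1) (u j b 0) *: 'X^j in
  (mmap (fun c : R => (mpolyC n c)%:P) (fun k => col_mx xs us k 0) Phi)`_i.

Definition F_coef (R : realType) (n m : nat)
    (f : 'cV[mpoly n R]_n) (g : 'M[mpoly n R]_(n, m)) (Phi : mpoly (n + m) R)
    (V : nat -> mpoly n R) (u : nat -> 'cV[mpoly n R]_m) (C : R) (i : nat) :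
    mpoly n R :=
  dot f (gradient (V i))
  + \sum_(1 <= j < i.+1) dot (g *m u j) (gradient (V (i - j)%N))
  + phi_coef Phi u i - mpolyC n C.

Definition update (T : Type) (s : nat -> T) (i : nat) (a : T) : nat -> T :=
  fun j => if j == i then a else s j.

Section ProcedureAI.

Variables (R : realType) (n m : nat).
Variables (f : 'cV[mpoly n R]_n) (g : 'M[mpoly n R]_(n, m)).
Variables (Phi : mpoly (n + m) R) (dV du : nat).

Definition step0_feasible (c : R) (W : mpoly n R) : Prop :=
  degree_le dV W /\
  is_sos (- F_coef f g Phi (fun=> W) (fun=> 0) c 0).

(* Only the entries of index < i of C, V and u (and index >= 1 for u) matter.
   [conservative] selects the variant in which all multipliers S_j vanish. *)
Definition step_feasible (conservative : bool) (C : nat -> R)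
    (V : nat -> mpoly n R) (u : nat -> 'cV[mpoly n R]_m) (i : nat)
    (c : R) (W : mpoly n R) (w : 'cV[mpoly n R]_m) : Prop :=
  [/\ degree_le dV W,
      forall b, degree_le du (w b 0) &
      exists S : nat -> mpoly n R,
        (forall j, (j < i)%N -> is_sos (S j) /\ (conservative -> S j = 0)) /\
        is_sos (- F_coef f g Phi (update V i W) (update u i w) c i
                + \sum_(0 <= j < i) S j * F_coef f g Phi V u (C j) j)].

(* C i, V i (i >= 0) and u i (i >= 1) are produced by the sequential procedure;
   u 0 is a dummy.  The variant may be chosen independently at each step. *)
Definition procedure_AI (conservative : nat -> bool) (C : nat -> R)
    (V : nat -> mpoly n R) (u : nat -> 'cV[mpoly n R]_m) : Prop :=
  [/\ step0_feasible (C 0%N) (V 0%N),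
      forall c W, step0_feasible c W -> C 0%N <= c &
      forall i, (1 <= i)%N ->
        step_feasible (conservative i) C V u i (C i) (V i) (u i) /\
        forall c W w,
          step_feasible (conservative i) C V u i c W w -> C i <= c].

End ProcedureAI.

(* Solutions on [0, +oo): continuous up to t = 0, and solving the ODE for
   t > 0. *)
Definition closed_loop_trajectory (R : realType) (n m : nat)
    (f : 'cV[mpoly n R]_n) (g : 'M[mpoly n R]_(n, m))
    (k : 'cV[R]_n -> 'cV[R]_m) (x : R -> 'cV[R]_n) : Prop :=
  (forall a, {within `[0, +oo[, continuous (fun t : R => x t a 0 : R)}) /\
  (forall t : R, 0 < t -> forall a,
     is_derive t (1 : R) (fun s : R => x s a 0)
       ((mxpeval f (x t) + mxpeval g (x t) *m k (x t)) a 0)).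

Definition bounded_trajectory (R : realType) (n : nat) (x : R -> 'cV[R]_n) :
    Prop :=
  exists M : R, forall t : R, 0 <= t -> forall a, `|x t a 0| <= M.

Definition time_average_cost (R : realType) (n m : nat) (Phi : mpoly (n + m) R)
    (k : 'cV[R]_n -> 'cV[R]_m) (x : R -> 'cV[R]_n) (T : R) : R :=
  T^-1 * (\int[lebesgue_measure]_(t in `[0, T])
            peval Phi (col_mx (x t) (k (x t))))%R.

(* Main.v *)
Require Import Defs.
From HB Require Import structures.
From mathcomp Require Import all_boot all_order all_algebra.
From mathcomp Require Import all_classical all_reals all_analysis.
From mathcomp Require Import lra ring.
Set Implicit Arguments.
Unset Strict Implicit.
Unset Printing Implicit Defensive.
Import Order.TTheory GRing.Theory Num.Theory.
Import numFieldNormedType.Exports.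
Local Open Scope classical_set_scope.
Local Open Scope ring_scope.

(** Why the bound holds.  At each step of the procedure the polynomial -F_i
    plus a combination of the earlier F_j with sum-of-squares multipliers is a
    sum of squares, so by induction F_i <= 0 at every point of the state space
    ([F_coef_le0]).  Formally F = \sum_i eps^i F_i, hence one expects
    F(V_SOS, u_SOS, C_SOS) <= 0, which is a dissipation inequality

      d/dt V_SOS(x(t)) + Phi(x(t), u_SOS(x(t))) <= C_SOS

    along closed-loop trajectories.  Integrating it over [0, T], dividing by T
    and using that V_SOS stays bounded on a bounded trajectory gives the claim
    ([average_le_of_dissipation]).

    Two points need an argument, because the three series are only assumed to
    converge pointwise, and possibly conditionally.

    The first is that V_SOS has to be differentiated, and its gradient has to
    be the limit of the gradients of the partial sums.  All partial sums have
    degree at most d_V, so they live in a finite-dimensional space; there, by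
    interpolation on a grid ([grid_interpolation]), pointwise convergence
    implies convergence of every linear functional, in particular of the value
    of a partial derivative at a point.  So V_SOS and u_SOS are polynomials
    ([series_bounded_degree]).

    The second is that F contains products of the series, and Cauchy products of
    conditionally convergent series may diverge at eps itself.  So fix a point
    x, truncate the three series at order N and regard F as a polynomial P_N in
    a formal parameter; its coefficients of index i < N are the numbers F_i(x),
    which are nonpositive ([F_trunc_coef]).  At a parameter e < eps the
    coefficients of index >= N contribute at most K (e / r)^N for any r strictly
    between e and eps, since the partial sums are bounded in the weighted l1
    norm of radius r, which is submultiplicative ([horner_le_tail]).  By Abel's
    theorem, in a form where the truncation order tends to infinity and e tends
    to eps from the left jointly ([cvg_abel]), P_N(e) tends to
    F(V_SOS, u_SOS, C_SOS)(x), which is therefore nonpositive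
    ([abel_limit_le0]). *)

(** * Multivariate polynomials of bounded degree *)

(** Induction along the ring structure: unlike induction on the support, it
    reduces a property to constants, variables, sums and products, which is how
    continuity, differentiability, boundedness and majorization propagate. *)
Lemma mpoly_ring_ind (n : nat) (R : realType) (P : mpoly n R -> Prop) :
  (forall c, P (mpolyC n c)) ->
  (forall a, P (mpolyX R (mnm1 a))) ->
  (forall p q, P p -> P q -> P (p + q)) ->
  (forall p q, P p -> P q -> P (p * q)) ->
  forall p, P p.
Proof.
move=> PC PX PD PM; elim/mpolyind => [|c m p _ _ Pp].
  by rewrite -(mpolyC0 n R); apply: PC.
apply: PD => //; rewrite -mul_mpolyC; apply: (PM); first exact: PC.
rewrite mpolyXE_id; elim/big_ind: _ => [|p1 p2|a _]; [|exact: PM|].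
  by rewrite -mpolyC1; apply: (PC).
elim: (m a) => [|k IHk]; first by rewrite expr0 -mpolyC1; apply: PC.
by rewrite exprS; apply: (PM).
Qed.

Lemma rmorph_mmap (n : nat) (R : comNzRingType) (S S' : comNzRingType)
    (phi : {rmorphism S -> S'}) (c : R -> S) (h : 'I_n -> S) (p : mpoly n R) :
  phi (mmap c h p) = mmap (phi \o c) (phi \o h) p.
Proof.
rewrite /mmap rmorph_sum; apply: eq_bigr => m _.
rewrite rmorphM /mmap1 rmorph_prod; congr (_ * _).
by apply: eq_bigr => a _; rewrite rmorphXn.
Qed.

Lemma cvg_bigsum (R : realType) (T : Type) (F : set_system T) {FF : Filter F}
    (I : Type) (r : seq I) (h : I -> T -> R) (l : I -> R) :
  (forall i, h i @ F --> l i) ->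
  (\sum_(i <- r) h i t) @[t --> F] --> \sum_(i <- r) l i.
Proof.
move=> hl; elim: r => [|i r IHr].
  by under eq_fun do rewrite big_nil; rewrite big_nil; apply: cvg_cst.
by under eq_fun do rewrite big_cons; rewrite big_cons; apply: cvgD.
Qed.

Lemma cvg_meval (R : realType) (n : nat) (T : Type) (F : set_system T)
    {FF : Filter F} (p : mpoly n R) (y : T -> 'I_n -> R) (l : 'I_n -> R) :
  (forall a, y t a @[t --> F] --> l a) ->
  meval (y t) p @[t --> F] --> meval l p.
Proof.
move=> yl; elim/mpoly_ring_ind: p => [c|a|p q IHp IHq|p q IHp IHq].
- by under eq_fun do rewrite mevalC; rewrite mevalC; apply: cvg_cst.
- by under eq_fun do rewrite mevalXU; rewrite mevalXU; apply: yl.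
- by under eq_fun do rewrite mevalD; rewrite mevalD; apply: cvgD.
- by under eq_fun do rewrite mevalM; rewrite mevalM; apply: cvgM.
Qed.

Lemma Vandermonde_nat_unit (R : realType) (d : nat) :
  Vandermonde d.+1 (\row_(k < d.+1) (k%:R : R)) \in unitmx.
Proof.
rewrite unitmxE det_Vandermonde unitfE.
apply/prodf_neq0 => i _; apply/prodf_neq0 => j ij.
by rewrite !mxE subr_eq0 eqr_nat gtn_eqF.
Qed.

(** Tensor-product Lagrange interpolation on the grid {0, ..., d}^n.  In one
    variable the interpolation weights are the rows of the inverse Vandermonde
    matrix of the nodes 0, ..., d; a monomial is a product of powers of single
    variables, so the multivariate identity is the distribution of a product of
    one-variable sums. *)
Lemma grid_interpolation (R : realType) (n d : nat) :
  exists l : {ffun 'I_n -> 'I_d.+1} -> mpoly n R,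
  forall p : mpoly n R, degree_le d p ->
    p = \sum_(k : {ffun 'I_n -> 'I_d.+1}) peval p (\col_a (k a)%:R) *: l k.
Proof.
pose VM := Vandermonde d.+1 (\row_(k < d.+1) (k%:R : R)).
pose W := invmx VM.
have VW (i j : 'I_d.+1) : \sum_(k < d.+1) k%:R ^+ i * W k j = (i == j)%:R.
  have : (VM *m W) i j = (i == j)%:R.
    by rewrite mulmxV ?Vandermonde_nat_unit// mxE.
  by rewrite mxE => <-; apply: eq_bigr => k _; rewrite !mxE.
(* The k-th Lagrange polynomial of the nodes 0, ..., d, in the variable a. *)
pose l1 (k : 'I_d.+1) (a : 'I_n) : mpoly n R :=
  \sum_(b < d.+1) W k b *: mpolyX R (mnm1 a) ^+ b.
exists (fun k : {ffun 'I_n -> 'I_d.+1} => \prod_a l1 (k a) a) => p dp.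
have mono (m : multinom n) : (forall a, (m a < d.+1)%N) ->
    \sum_(k : {ffun 'I_n -> 'I_d.+1})
      peval (mpolyX R m) (\col_a (k a)%:R) *: \prod_a l1 (k a) a = mpolyX R m.
  move=> md; rewrite (mpolyXE_id R m).
  transitivity (\prod_(a < n) \sum_(k < d.+1) k%:R ^+ m a *: l1 k a).
    rewrite bigA_distr_bigA; apply: eq_bigr => k _.
    rewrite /peval -mpolyXE_id mevalX scaler_prod; congr (_ *: _).
    by apply: eq_bigr => a _; rewrite mxE.
  apply: eq_bigr => a _; rewrite /l1.
  under eq_bigr do rewrite scaler_sumr.
  rewrite exchange_big /= (bigD1 (Ordinal (md a)))//= [X in _ + X]big1 => [|b ba].
    under eq_bigr do rewrite scalerA.
    rewrite -scaler_suml (VW (Ordinal (md a)) (Ordinal (md a))).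
    by rewrite eqxx scale1r addr0.
  under eq_bigr do rewrite scalerA.
  by rewrite -scaler_suml (VW (Ordinal (md a)) b) eq_sym (negbTE ba) scale0r.
have pE x : peval p x =
    \sum_(m : bmultinom n d.+1) mcoeff m p * peval (mpolyX R m) x.
  rewrite {1}(mpolywE dp) /peval raddf_sum.
  by apply: eq_bigr => m _; apply: mevalZ.
have ltmd (m : bmultinom n d.+1) a : (m a < d.+1)%N.
  apply: leq_ltn_trans (bmdeg m); rewrite mdegE (bigD1 a)//=.
  exact: leq_addr.
rewrite {1}(mpolywE dp); symmetry.
transitivity (\sum_(k : {ffun 'I_n -> 'I_d.+1}) \sum_(m : bmultinom n d.+1)
    mcoeff m p *: (peval (mpolyX R m) (\col_a (k a)%:R) *: \prod_a l1 (k a) a)).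
  apply: eq_bigr => k _; rewrite pE scaler_suml; apply: eq_bigr => m _.
  by rewrite scalerA.
rewrite exchange_big /=; apply: eq_bigr => m _.
by rewrite -scaler_sumr mono.
Qed.

(** On polynomials of degree at most d a linear functional is a finite
    combination of evaluations at grid points, so it inherits convergence from
    pointwise convergence; the limit polynomial interpolates L on the grid. *)
Lemma cvg_poly_bounded_degree (R : realType) (n d : nat)
    (p : nat -> mpoly n R) (L : 'cV[R]_n -> R) :
  (forall N, degree_le d (p N)) ->
  (forall x, peval (p N) x @[N --> \oo] --> L x) ->
  exists Q : mpoly n R, forall phi : {scalar mpoly n R},
    phi (p N) @[N --> \oo] --> phi Q.
Proof.
move=> dp pL; have [l lE] := grid_interpolation R n d.
exists (\sum_(k : {ffun 'I_n -> 'I_d.+1}) L (\col_a (k a)%:R) *: l k) => phi.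
rewrite linear_sum.
under eq_fun do rewrite (lE _ (dp _)) linear_sum.
apply: cvg_bigsum => k; under eq_fun do rewrite linearZ.
by rewrite linearZ; apply: cvgMl => //; apply: pL.
Qed.

(** * Abel summation and coefficientwise majorants *)

(** Abel's summation by parts, centred at the candidate limit l. *)
Lemma sum_by_parts (R : comNzRingType) (a : nat -> R) (l s : R) (N : nat) :
  \sum_(0 <= i < N) a i * s ^+ i - l =
  (\sum_(0 <= i < N) a i - l) * s ^+ N +
  (1 - s) * \sum_(0 <= i < N) (\sum_(0 <= j < i.+1) a j - l) * s ^+ i.
Proof.
elim: N => [|N IHN].
  by rewrite !big_geq// expr0 mulr1 mulr0 addr0.
rewrite big_nat_recr//= addrAC IHN.
have AS : \sum_(0 <= i < N.+1) a i - l = (\sum_(0 <= i < N) a i - l) + a N.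
  by rewrite big_nat_recr//= addrAC.
rewrite [X in _ = _ + _ * X]big_nat_recr//= AS.
rewrite exprS.
set A := \sum_(0 <= i < N) a i - l; set B := \sum_(0 <= i < N) _ * _.
by ring.
Qed.

(** The estimate behind Abel's theorem, uniform in the order N of truncation.
    In the summation by parts, the weights (1 - s) s^i have total mass at most 1,
    so only the finitely many i < N0 where the partial sums are still far from l
    matter, and these carry the factor 1 - s. *)
Lemma abel_uniform (R : realType) (a : nat -> R) (l : R) :
  \sum_(0 <= i < N) a i @[N --> \oo] --> l ->
  forall d, 0 < d -> exists (N0 : nat) (K : R), 0 <= K /\
    forall s N, 0 <= s < 1 -> (N0 <= N)%N ->
      `|\sum_(0 <= i < N) a i * s ^+ i - l| <= d + (1 - s) * K.
Proof.
move=> al d d0.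
have d20 : 0 < d / 2 by rewrite divr_gt0.
move/cvgrPdist_le: (al) => /(_ _ d20)[N0 _ HN0].
have {}HN0 N : (N0 <= N)%N -> `|\sum_(0 <= i < N) a i - l| <= d / 2.
  by move=> NN0; rewrite distrC; apply: HN0.
pose K := \sum_(0 <= i < N0) `|\sum_(0 <= j < i.+1) a j - l|.
exists N0, K; split=> [|s N /andP[s0 s1] NN0]; first exact: sumr_ge0.
have s1' : 0 <= 1 - s by rewrite subr_ge0 ltW.
have sX i : s ^+ i <= 1 by rewrite exprn_ile1// ltW.
rewrite sum_by_parts (le_trans (ler_normD _ _))//.
rewrite [d]splitr -addrA lerD//.
  rewrite normrM (ger0_norm (exprn_ge0 _ s0)).
  by apply: le_trans (HN0 _ NN0); apply: ler_piMr.
rewrite normrM ger0_norm//.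
apply: (@le_trans _ _ ((1 - s) * (K + d / 2 * \sum_(0 <= i < N) s ^+ i))).
  apply: ler_wpM2l => //; apply: le_trans (ler_norm_sum _ _ _) _.
  rewrite (big_cat_nat (leq0n N0) NN0)//=; apply: lerD.
    apply: ler_sum => i _; rewrite normrM (ger0_norm (exprn_ge0 _ s0)).
    by rewrite ler_piMr.
  rewrite (big_cat_nat (leq0n N0) NN0 (F := fun i => s ^+ i))//= mulrDr.
  apply: ler_wpDl.
    by rewrite mulr_ge0 ?(ltW d20)//; apply: sumr_ge0 => i _; apply: exprn_ge0.
  rewrite mulr_sumr !big_nat; apply: ler_sum => i /andP[iN0 _].
  rewrite normrM (ger0_norm (exprn_ge0 _ _))// ler_wpM2r ?exprn_ge0//.
  by apply: HN0; rewrite leqW.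
rewrite mulrDr [leRHS]addrC lerD2l mulrCA big_mkord.
have -> : (1 - s) * \sum_(i < N) s ^+ i = 1 - s ^+ N.
  by rewrite -[RHS]opprB subrX1 -mulNr opprB.
by apply: ler_piMr; [exact: ltW|rewrite lerBlDr lerDl exprn_ge0].
Qed.

(** Abel's theorem along the product filter: the truncation order and the
    parameter move together, so that limits of polynomial expressions in several
    such sums can be taken at once, without Cauchy products of series. *)
Lemma cvg_abel (R : realType) (a : nat -> R) (l e0 : R) :
  0 < e0 ->
  \sum_(0 <= i < N) e0 ^+ i * a i @[N --> \oo] --> l ->
  \sum_(0 <= i < z.1) a i * z.2 ^+ i
    @[z --> filter_prod (\oo : set_system nat) e0^'-] --> l.
Proof.
move=> e0_gt0 al; apply/cvgrPdist_le => d d0.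
have d20 : 0 < d / 2 by rewrite divr_gt0.
have [N0 [K [K0 HK]]] := abel_uniform al d20.
have K1 : 0 < K + 1 by lra.
(* The lower bound on e says that 1 - e / e0 <= d / (2 (K + 1)). *)
exists ([set N | (N0 <= N)%N],
  [set e | [/\ 0 <= e, e < e0 & e0 - d / 2 / (K + 1) * e0 <= e]]).
  split => /=; first by exists N0.
  near=> e; split.
  - by near: e; apply: nbhs_left_ge.
  - by near: e; apply: nbhs_left_lt.
  - near: e; apply: nbhs_left_ge; rewrite ltrBlDr ltrDl mulr_gt0//.
    by rewrite divr_gt0.
move=> [N e] /= [NN0 [e_ge0 e_lt ed]].
have s01 : 0 <= e / e0 < 1 by rewrite divr_ge0 ?(ltW e0_gt0)//= ltr_pdivrMr// mul1r.
have := HK _ _ s01 NN0; rewrite distrC.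
have -> : \sum_(0 <= i < N) e0 ^+ i * a i * (e / e0) ^+ i =
          \sum_(0 <= i < N) a i * e ^+ i.
  apply: eq_bigr => i _; rewrite [_ * a i]mulrC -mulrA -exprMn mulrCA divff ?mulr1//.
  exact: lt0r_neq0.
move=> /le_trans; apply.
rewrite [leRHS]splitr lerD2l.
have h1 : 1 - e / e0 <= d / 2 / (K + 1).
  rewrite -(ler_pM2r e0_gt0) mulrBl mul1r divfK ?lt0r_neq0//; lra.
have h2 : (1 - e / e0) * K <= d / 2 / (K + 1) * K by apply: ler_wpM2r.
apply: le_trans h2 _; rewrite -mulrA ler_piMr ?ltW//.
by rewrite mulrC ltr_pdivrMr//; lra.
Unshelve. all: by end_near. Qed.

(** Boundedness of a sequence of polynomials in the norm \sum_i |p_i| r^i.  An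
    explicit majorant q, whose norm is just its value at r, makes the
    stability under products immediate. *)
Definition majorized (R : realType) (r : R) (p : nat -> {poly R}) : Prop :=
  exists (q : nat -> {poly R}) (K : R), forall N,
    (forall i, `|(p N)`_i| <= (q N)`_i) /\ (q N).[r] <= K.

Lemma majorant_ge0 (R : realType) (p q : {poly R}) :
  (forall i, `|p`_i| <= q`_i) -> forall i, 0 <= q`_i.
Proof. by move=> pq i; apply: le_trans (pq i). Qed.

Lemma horner_ge0 (R : realType) (q : {poly R}) (r : R) :
  0 <= r -> (forall i, 0 <= q`_i) -> 0 <= q.[r].
Proof.
move=> r0 q0; rewrite horner_coef; apply: sumr_ge0 => i _.
by rewrite mulr_ge0 ?exprn_ge0.
Qed.

Lemma majorizedC (R : realType) (r c : R) : majorized r (fun=> c%:P).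
Proof.
exists (fun=> `|c|%:P), `|c| => N; split => [i|]; last by rewrite hornerC.
by rewrite !coefC; case: ifP; rewrite ?normr0.
Qed.

Lemma majorizedD (R : realType) (r : R) (p1 p2 : nat -> {poly R}) :
  majorized r p1 -> majorized r p2 -> majorized r (fun N => p1 N + p2 N).
Proof.
move=> [q1 [K1 H1]] [q2 [K2 H2]]; exists (fun N => q1 N + q2 N), (K1 + K2) => N.
have [[c1 k1] [c2 k2]] := (H1 N, H2 N).
split => [i|]; last by rewrite hornerD lerD.
by rewrite !coefD (le_trans (ler_normD _ _))// lerD.
Qed.

Lemma majorizedM (R : realType) (r : R) (p1 p2 : nat -> {poly R}) :
  0 <= r ->
  majorized r p1 -> majorized r p2 -> majorized r (fun N => p1 N * p2 N).
Proof.
move=> r0 [q1 [K1 H1]] [q2 [K2 H2]]; exists (fun N => q1 N * q2 N), (K1 * K2) => N.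
have [[c1 k1] [c2 k2]] := (H1 N, H2 N).
split => [i|].
  rewrite !coefM (le_trans (ler_norm_sum _ _ _))//; apply: ler_sum => j _.
  by rewrite normrM ler_pM.
by rewrite hornerM ler_pM// horner_ge0//; apply: majorant_ge0.
Qed.

Lemma majorized_sum (R : realType) (r : R) (I : Type) (s : seq I)
    (p : I -> nat -> {poly R}) :
  (forall i, majorized r (p i)) -> majorized r (fun N => \sum_(i <- s) p i N).
Proof.
move=> Hp; elim: s => [|i s IHs].
  by under eq_fun do rewrite big_nil; apply: (majorizedC r 0).
by under eq_fun do rewrite big_cons; apply: majorizedD.
Qed.

Lemma majorized_mmap (R : realType) (r : R) (k : nat) (p : mpoly k R)
    (h : nat -> 'I_k -> {poly R}) :
  0 <= r -> (forall a, majorized r (fun N => h N a)) ->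
  majorized r (fun N => mmap (@polyC R) (h N) p).
Proof.
move=> r0 Hh; elim/mpoly_ring_ind: p => [c|a|p q IHp IHq|p q IHp IHq].
- by under eq_fun do rewrite mmapC; apply: majorizedC.
- by under eq_fun do rewrite mmapX mmap1U; apply: Hh.
- by under eq_fun do rewrite mmapD; apply: majorizedD.
- under eq_fun do rewrite (mmap_is_multiplicative _ _).1.
  exact: majorizedM.
Qed.

(** The terms of a series that converges at e0 are bounded, so at r < e0 its
    truncations are dominated by a geometric series of ratio r / e0. *)
Lemma majorized_truncation (R : realType) (a : nat -> R) (e0 r : R) :
  0 < e0 -> 0 <= r < e0 ->
  cvgn (fun N => \sum_(0 <= i < N) e0 ^+ i * a i) ->
  majorized r (fun N => \poly_(i < N) a i).
Proof.
move=> e0_gt0 /andP[r0 re0] /(@cvg_series_cvg_0 _ R^o (fun i => e0 ^+ i * a i)) a0.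
have [M [_ HM]] := cvg_seq_bounded (cvgP _ a0).
have {HM} HM i : `|e0 ^+ i * a i| <= M + 1 by apply: HM => //; lra.
have rn1 : r / e0 < 1 by rewrite ltr_pdivrMr// mul1r.
have q0 : 0 <= r / e0 by rewrite divr_ge0// ltW.
exists (fun N => \poly_(i < N) `|a i|), ((M + 1) / (1 - r / e0)) => N; split=> [i|].
  by rewrite !coef_poly; case: ifP; rewrite ?normr0.
rewrite horner_poly ler_pdivlMr ?subr_gt0//.
apply: (@le_trans _ _ ((\sum_(i < N) (M + 1) * (r / e0) ^+ i) * (1 - r / e0))).
  apply: ler_wpM2r; first by rewrite subr_ge0 ltW.
  apply: ler_sum => i _; rewrite exprMn exprVn mulrCA mulrC.
  rewrite ler_wpM2l ?exprn_ge0// ler_pdivlMr ?exprn_gt0// mulrC.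
  by rewrite -[X in X * _](ger0_norm (exprn_ge0 i (ltW e0_gt0))) -normrM.
rewrite -mulr_sumr -mulrA ler_piMr//; first exact: le_trans (HM 0%N).
by rewrite mulrC -[X in X * _]opprB mulNr -subrX1 opprB lerBlDr lerDl exprn_ge0.
Qed.

(** The terms of index i < N are nonpositive, and each later one gains the
    factor (e / r)^i <= (e / r)^N over its majorant at r. *)
Lemma horner_le_tail (R : realType) (p q : {poly R}) (e r : R) (N : nat) :
  0 <= e -> 0 < r -> e <= r ->
  (forall i, (i < N)%N -> p`_i <= 0) -> (forall i, `|p`_i| <= q`_i) ->
  p.[e] <= (e / r) ^+ N * q.[r].
Proof.
move=> e0 r0 er pN pq.
pose k := maxn (size p) (size q).
rewrite (@horner_coef_wide _ k p) ?leq_maxl// (@horner_coef_wide _ k q) ?leq_maxr//.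
have er0 : 0 <= e / r by rewrite divr_ge0// ltW.
rewrite mulr_sumr; apply: ler_sum => i _.
have qi := majorant_ge0 pq i.
have [iN|Ni] := ltnP i N.
  apply: (@le_trans _ _ 0); last by rewrite !mulr_ge0 ?exprn_ge0// ltW.
  by rewrite mulr_le0_ge0 ?exprn_ge0// pN.
rewrite (le_trans (ler_norm _))// normrM (ger0_norm (exprn_ge0 _ e0)).
apply: (@le_trans _ _ (q`_i * e ^+ i)); first by rewrite ler_wpM2r ?exprn_ge0.
rewrite mulrCA ler_wpM2l// -[e in leLHS](divfK (lt0r_neq0 r0)) exprMn.
rewrite ler_wpM2r ?exprn_ge0 ?(ltW r0)//.
by apply: ler_wiXn2l => //; rewrite ler_pdivrMr// mul1r.
Qed.

(** For each fixed e < e0 the value (P N).[e] is asymptotically nonpositive by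
    [horner_le_tail], applied with r halfway between e and e0.  Joint convergence
    allows e to be chosen first, then N depending on e. *)
Lemma abel_limit_le0 (R : realType) (e0 l : R) (P : nat -> {poly R}) :
  0 < e0 ->
  (forall r, 0 < r < e0 -> majorized r P) ->
  (forall N i, (i < N)%N -> (P N)`_i <= 0) ->
  (P z.1).[z.2] @[z --> filter_prod (\oo : set_system nat) e0^'-] --> l ->
  l <= 0.
Proof.
move=> e0_gt0 majP P0 Pl; apply/ler_addgt0Pr => d d0; rewrite add0r.
have d20 : 0 < d / 2 by rewrite divr_gt0.
move/cvgrPdist_le: (Pl) => /(_ _ d20)[[/= A B] [/= FA FB] AB].
have near_e : \forall e \near e0^'-, (B e /\ 0 < e) /\ e < e0.
  near=> e; split; [split|]; near: e => //.
    exact: nbhs_left_gt.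
  exact: nbhs_left_lt.
have [e [[Be e_gt] e_lt]] := @filter_ex _ e0^'- _ _ near_e.
pose r := (e + e0) / 2.
have [q [K HK]] := majP r ltac:(rewrite /r; apply/andP; split; lra).
have er : e < r by rewrite /r; lra.
have r0 : 0 < r by apply: lt_trans er.
have K0 : 0 <= K.
  have [c k] := HK 0%N; apply: le_trans k; apply: horner_ge0; first exact: ltW.
  exact: majorant_ge0 c.
have er1 : `|e / r| < 1.
  by rewrite ger0_norm ?ltr_pdivrMr ?mul1r// divr_ge0// ltW.
have geo : (e / r) ^+ N * K @[N --> \oo] --> 0.
  by rewrite -(mul0r K); apply: cvgMl => //; apply: cvg_expr.
have near_N : \forall N \near \oo, A N /\ (e / r) ^+ N * K <= d / 2.
  near=> N; split; near: N => //; apply: cvgr_le geo _ _ => //.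
have [N [AN geoN]] := @filter_ex _ (\oo : set_system nat) _ _ near_N.
have [c k] := HK N.
have := horner_le_tail (ltW e_gt) r0 (ltW er) (P0 N) c.
have : (e / r) ^+ N * (q N).[r] <= (e / r) ^+ N * K.
  by rewrite ler_wpM2l// exprn_ge0// divr_ge0// ltW.
have := AB (N, e) (conj AN Be); rewrite /= => /ler_normlP[_].
by lra.
Unshelve. all: by end_near. Qed.

(** * The sequential sum-of-squares procedure and its truncations *)

Lemma meval_sum (R : realType) (n : nat) (v : 'I_n -> R) (I : Type) (s : seq I)
    (P : pred I) (F : I -> mpoly n R) :
  meval v (\sum_(i <- s | P i) F i) = \sum_(i <- s | P i) meval v (F i).
Proof. exact: raddf_sum. Qed.

Lemma is_sos_ge0 (R : realType) (n : nat) (p : mpoly n R) (x : 'cV[R]_n) :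
  is_sos p -> 0 <= peval p x.
Proof.
move=> [s ->]; rewrite /peval meval_sum; apply: sumr_ge0 => q _ /=.
by rewrite expr2 mevalM -expr2 sqr_ge0.
Qed.

Lemma update_same (T : Type) (s : nat -> T) (i : nat) : update s i (s i) = s.
Proof. by apply/funext => j; rewrite /update; case: eqP => // ->. Qed.

Lemma eq_mmap (n : nat) (R S : nzRingType) (c1 c2 : R -> S) (h1 h2 : 'I_n -> S)
    (p : mpoly n R) :
  c1 =1 c2 -> h1 =1 h2 -> mmap c1 h1 p = mmap c2 h2 p.
Proof.
move=> c12 h12; rewrite /mmap; apply: eq_bigr => m _; rewrite c12 /mmap1.
by congr (_ * _); apply: eq_bigr => a _; rewrite h12.
Qed.

(** The multipliers S_j are nonnegative and the earlier F_j are nonpositive by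
    induction, so F_i <= \sum_(j < i) S_j F_j <= 0 pointwise. *)
Lemma F_coef_le0 (R : realType) (n m : nat)
    (f : 'cV[mpoly n R]_n) (g : 'M[mpoly n R]_(n, m)) (Phi : mpoly (n + m) R)
    (dV du : nat) (conservative : nat -> bool)
    (C : nat -> R) (V : nat -> mpoly n R) (u : nat -> 'cV[mpoly n R]_m) :
  procedure_AI f g Phi dV du conservative C V u ->
  forall (i : nat) (x : 'cV[R]_n), peval (F_coef f g Phi V u (C i) i) x <= 0.
Proof.
move=> [[_ sos0] _ hstep] i x; elim/ltn_ind: i => -[_|i IHi].
  (* F_0 involves only V_0: all sums over the controls are empty. *)
  have -> : F_coef f g Phi V u (C 0%N) 0 =
            F_coef f g Phi (fun=> V 0%N) (fun=> 0) (C 0%N) 0.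
    rewrite /F_coef /phi_coef !(big_geq (leqnn 1)); congr (_ + _`_0 - _).
    congr polyseq; apply: eq_mmap => // k; congr (col_mx _ _ k 0).
    by apply/matrixP => b c; rewrite !mxE !big_geq.
  by have := is_sos_ge0 x sos0; rewrite /peval raddfN oppr_ge0.
have [[_ _ [S [sosS sosF]]] _] := hstep i.+1 isT.
move: sosF; rewrite !update_same => /(is_sos_ge0 x).
rewrite /peval mevalD mevalN meval_sum addrC subr_ge0 => /le_trans; apply.
rewrite big_nat; apply: sumr_le0 => j /andP[_ ji]; rewrite mevalM.
apply: mulr_ge0_le0; last exact: IHi.
by have [sosj _] := sosS j ji; apply: (is_sos_ge0 x).
Qed.

(** Substitution of power series in a polynomial respects truncation: the
    coefficients up to i of the result depend only on the coefficients up to i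
    of the substituted series. *)
Lemma coef_mmap_low (R : realType) (k i : nat) (h1 h2 : 'I_k -> {poly R})
    (p : mpoly k R) :
  (forall a j, (j <= i)%N -> (h1 a)`_j = (h2 a)`_j) ->
  forall j, (j <= i)%N -> (mmap (@polyC R) h1 p)`_j = (mmap (@polyC R) h2 p)`_j.
Proof.
move=> h12; elim/mpoly_ring_ind: p => [c|a|p q IHp IHq|p q IHp IHq] j ji.
- by rewrite !mmapC.
- by rewrite !mmapX !mmap1U h12.
- by rewrite !mmapD !coefD IHp ?IHq.
- rewrite !(mmap_is_multiplicative _ _).1 !coefM; apply: eq_bigr => l _.
  by rewrite IHp ?IHq// (leq_trans _ ji)// ?leq_subr// -ltnS.
Qed.

Section TruncatedInequality.

Variables (R : realType) (n m : nat).
Variables (f : 'cV[mpoly n R]_n) (g : 'M[mpoly n R]_(n, m)).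
Variables (Phi : mpoly (n + m) R).
Variables (C : nat -> R) (V : nat -> mpoly n R) (u : nat -> 'cV[mpoly n R]_m).
Variable x : 'cV[R]_n.

(** The entry u_0 is a dummy; replacing it by 0 lets the control series start
    at index 0 like the other two. *)
Definition u_val (b : 'I_m) (j : nat) : R :=
  if j == 0%N then 0 else peval (u j b 0) x.

Definition dV_val (a : 'I_n) (j : nat) : R := peval (mderiv a (V j)) x.

Definition u_trunc (N : nat) : 'cV[{poly R}]_m :=
  \col_b \poly_(j < N) u_val b j.

(** The function F at the point x, with the three series truncated below order
    N and the expansion parameter as the indeterminate. *)
Definition F_trunc (N : nat) : {poly R} :=
  \sum_a ((peval (f a 0) x)%:P + \sum_b (peval (g a b) x)%:P * u_trunc N b 0)
         * \poly_(j < N) dV_val a j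
  + mmap (@polyC R) (fun k => col_mx (map_mx (@polyC R) x) (u_trunc N) k 0) Phi
  - \poly_(j < N) C j.

Lemma phi_coef_trunc (N i : nat) : (i < N)%N ->
  (mmap (@polyC R) (fun k => col_mx (map_mx (@polyC R) x) (u_trunc N) k 0) Phi)`_i
  = peval (phi_coef Phi u i) x.
Proof.
move=> iN; rewrite /peval /phi_coef.
set v := fun a => x a 0.
rewrite -[RHS](coef_map (meval v)) /= (rmorph_mmap (map_poly (meval v))).
rewrite [in RHS](@eq_mmap _ _ _ _ (@polyC R) _ _ _ _ (fun=> erefl)); last first.
  by move=> c /=; rewrite map_polyC /= mevalC.
apply: coef_mmap_low (leqnn i) => k j ji /=.
rewrite !mxE; case: (fintype.split k) => a; rewrite !mxE.
  by rewrite map_polyC /= mevalXU.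
rewrite coef_poly (leq_ltn_trans ji iN) coef_map coef_sum /= /u_val.
under eq_bigr do rewrite coefZ coefXn.
have [->|j0] := eqVneq j 0%N.
  rewrite big_nat big1 ?meval0// => l /andP[l1 _].
  by rewrite ltn_eqF ?mulr0.
rewrite (bigD1_seq j) ?iota_uniq//=; last by rewrite mem_index_iota lt0n j0.
rewrite eqxx mulr1 big1 ?addr0// => l /negbTE lj.
by rewrite eq_sym lj mulr0.
Qed.

(** The truncation at N cannot affect the coefficients of index i < N. *)
Lemma F_trunc_coef (N i : nat) : (i < N)%N ->
  (F_trunc N)`_i = peval (F_coef f g Phi V u (C i) i) x.
Proof.
move=> iN.
rewrite /F_trunc coefB coefD phi_coef_trunc// coef_poly iN.
rewrite /F_coef /peval mevalB mevalD mevalC; congr (_ + _ - _).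
rewrite mevalD meval_sum coef_sum /dot meval_sum.
have dE j a : (gradient (V j)) a 0 = mderiv a (V j) by rewrite mxE.
transitivity (\sum_a (peval (f a 0) x * dV_val a i +
   \sum_(1 <= j < i.+1) (\sum_b peval (g a b) x * u_val b j) * dV_val a (i - j))).
  apply: eq_bigr => a _; rewrite mulrDl coefD coefCM coef_poly iN; congr (_ + _).
  rewrite coefM.
  (* The term j = 0 of the Cauchy product vanishes since u_val b 0 = 0. *)
  rewrite -(big_mkord xpredT (fun j => (\sum_b (peval (g a b) x)%:P * u_trunc N b 0)`_j
     * (\poly_(j < N) dV_val a j)`_(i - j))) big_ltn//.
  rewrite coef_sum [X in X * _]big1 ?mul0r ?add0r => [|b _]; last first.
    by rewrite coefCM mxE coef_poly /u_val eqxx if_same mulr0.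
  rewrite !big_nat; apply: eq_bigr => j /andP[_ ji].
  rewrite !coef_poly (leq_ltn_trans (leq_subr _ _) iN) coef_sum; congr (_ * _).
  apply: eq_bigr => b _; rewrite coefCM mxE coef_poly.
  by rewrite (leq_ltn_trans _ iN).
rewrite big_split /=; congr (_ + _).
  by apply: eq_bigr => a _; rewrite mevalM dE.
rewrite exchange_big /= !big_nat; apply: eq_bigr => j /andP[j1 _].
rewrite meval_sum; apply: eq_bigr => a _; rewrite mevalM dE; congr (_ * _).
rewrite mxE meval_sum; apply: eq_bigr => b _; rewrite mevalM.
by rewrite /u_val (negbTE (lt0n_neq0 j1)).
Qed.

Lemma horner_truncation (a : nat -> R) (N : nat) (e : R) :
  (\poly_(j < N) a j).[e] = \sum_(0 <= j < N) a j * e ^+ j.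
Proof. by rewrite horner_poly big_mkord. Qed.

Lemma F_trunc_horner (N : nat) (e : R) :
  (F_trunc N).[e] =
  \sum_a (peval (f a 0) x
          + \sum_b peval (g a b) x * \sum_(0 <= j < N) u_val b j * e ^+ j)
         * \sum_(0 <= j < N) dV_val a j * e ^+ j
  + meval (fun k => col_mx x (\col_b \sum_(0 <= j < N) u_val b j * e ^+ j) k 0) Phi
  - \sum_(0 <= j < N) C j * e ^+ j.
Proof.
rewrite /F_trunc !hornerE horner_sum horner_truncation; congr (_ + _ - _).
  apply: eq_bigr => a _; rewrite hornerM hornerD hornerC horner_truncation.
  rewrite horner_sum; congr ((_ + _) * _); apply: eq_bigr => b _.
  by rewrite hornerM hornerC mxE horner_truncation.
rewrite -/(horner_eval e _) rmorph_mmap /meval; apply: eq_mmap => [c|k] /=.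
  by rewrite /horner_eval hornerC.
rewrite !mxE; case: (fintype.split k) => a; rewrite /horner_eval !mxE ?hornerC//.
by rewrite horner_truncation.
Qed.

End TruncatedInequality.

(** * Passing to the limit in the series *)

Lemma degree_le_partial_sum (R : realType) (n d : nat) (e : R)
    (p : nat -> mpoly n R) :
  (forall i, degree_le d (p i)) ->
  forall N, degree_le d (\sum_(0 <= i < N) e ^+ i *: p i).
Proof.
move=> dp N; rewrite /degree_le; elim/big_ind: _ => [|p1 p2 h1 h2|i _].
- by rewrite mmeasure0.
- by apply: leq_trans (mmeasureD_le _ _ _) _; rewrite geq_max h1 h2.
- by apply: leq_trans (mmeasureZ_le _ _ _) _; apply: dp.
Qed.

(** A pointwise convergent series of polynomials of bounded degree has a
    polynomial sum, and linear functionals, such as a partial derivative at a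
    point, can be applied term by term. *)
Lemma series_bounded_degree (R : realType) (n d : nat) (e : R)
    (p : nat -> mpoly n R) (L : 'cV[R]_n -> R) :
  (forall i, degree_le d (p i)) ->
  (forall x, \sum_(0 <= i < N) e ^+ i * peval (p i) x @[N --> \oo] --> L x) ->
  exists Q : mpoly n R, forall phi : {scalar mpoly n R},
    \sum_(0 <= i < N) e ^+ i * phi (p i) @[N --> \oo] --> phi Q.
Proof.
move=> dp pL.
have phi_sum (phi : {scalar mpoly n R}) N :
    phi (\sum_(0 <= i < N) e ^+ i *: p i) = \sum_(0 <= i < N) e ^+ i * phi (p i).
  by rewrite linear_sum; apply: eq_bigr => i _; rewrite linearZ.
have [|Q HQ] := cvg_poly_bounded_degree (L := L) (degree_le_partial_sum e dp).
  move=> x; have -> := funext (phi_sum (meval (fun a => x a 0))).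
  exact: pL.
by exists Q => phi; have <- := funext (phi_sum phi); apply: HQ.
Qed.

Lemma u_val_series (R : realType) (n m : nat) (u : nat -> 'cV[mpoly n R]_m)
    (x : 'cV[R]_n) (e : R) (b : 'I_m) (N : nat) :
  \sum_(0 <= j < N) e ^+ j * u_val u x b j =
  \sum_(1 <= j < N) e ^+ j * peval (u j b 0) x.
Proof.
case: N => [|N]; first by rewrite !big_geq.
rewrite big_ltn// /u_val eqxx mulr0 add0r !big_nat.
by apply: eq_bigr => j /andP[j1 _]; rewrite gtn_eqF.
Qed.

(** Nonpositivity of all the F_i at a point x passes to the value of F at the
    sums of the series.  Only the values at x of the controls and of the partial
    derivatives of V enter, so the statement is about numerical series. *)
Lemma F_limit_le0 (R : realType) (n m : nat)
    (f : 'cV[mpoly n R]_n) (g : 'M[mpoly n R]_(n, m)) (Phi : mpoly (n + m) R)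
    (C : nat -> R) (V : nat -> mpoly n R) (u : nat -> 'cV[mpoly n R]_m)
    (e : R) (x : 'cV[R]_n) (Clim : R) (ulim : 'cV[R]_m) (dVlim : 'I_n -> R) :
  0 < e ->
  (forall i, peval (F_coef f g Phi V u (C i) i) x <= 0) ->
  \sum_(0 <= i < N) e ^+ i * C i @[N --> \oo] --> Clim ->
  (forall b, \sum_(0 <= i < N) e ^+ i * u_val u x b i @[N --> \oo] --> ulim b 0) ->
  (forall a, \sum_(0 <= i < N) e ^+ i * dV_val V x a i @[N --> \oo] --> dVlim a) ->
  \sum_a (mxpeval f x + mxpeval g x *m ulim) a 0 * dVlim a
    + peval Phi (col_mx x ulim) - Clim <= 0.
Proof.
move=> e0 F0 Ccvg ucvg dVcvg.
apply: (@abel_limit_le0 _ e _ (F_trunc f g Phi C V u x)) => //.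
- move=> r /andP[r0 re].
  have rr : 0 <= r < e by rewrite ltW.
  have mu b : majorized r (fun N => u_trunc u x N b 0).
    under eq_fun do rewrite mxE.
    by apply: majorized_truncation rr _ => //; apply: cvgP (ucvg b).
  apply: majorizedD; first apply: majorizedD.
  + apply: majorized_sum => a; apply: majorizedM; first exact: ltW.
      apply: majorizedD; first exact: majorizedC.
      apply: majorized_sum => b; apply: majorizedM; first exact: ltW.
        exact: majorizedC.
      exact: mu.
    by apply: majorized_truncation rr _ => //; apply: cvgP (dVcvg a).
  + apply: majorized_mmap; first exact: ltW.
    move=> k; under eq_fun do rewrite mxE.
    case: (fintype.split k) => a; last exact: mu.
    by rewrite mxE; apply: majorizedC.
  + under eq_fun do rewrite -mulN1r -polyCN.
    apply: majorizedM; [exact: ltW|exact: majorizedC|].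
    by apply: majorized_truncation rr _ => //; apply: cvgP Ccvg.
- by move=> N i iN; rewrite F_trunc_coef.
- under eq_fun do rewrite F_trunc_horner.
  apply: cvgB; last exact: cvg_abel.
  apply: cvgD.
    apply: cvg_bigsum => a; apply: cvgM; last exact: cvg_abel.
    rewrite !mxE; apply: cvgD; first exact: cvg_cst.
    apply: cvg_bigsum => b; rewrite mxE; apply: cvgM; first exact: cvg_cst.
    exact: cvg_abel.
  apply: cvg_meval => k; rewrite mxE; under eq_fun do rewrite mxE.
  case: (fintype.split k) => a; first exact: cvg_cst.
  by under eq_fun do rewrite mxE; apply: cvg_abel.
Qed.

Lemma closed_loop_dissipation (R : realType) (n m : nat)
    (f : 'cV[mpoly n R]_n) (g : 'M[mpoly n R]_(n, m)) (Phi : mpoly (n + m) R)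
    (dV du : nat) (eps : R) (conservative : nat -> bool)
    (C : nat -> R) (V : nat -> mpoly n R) (u : nat -> 'cV[mpoly n R]_m)
    (C_SOS : R) (u_SOS : 'cV[R]_n -> 'cV[R]_m) (V_SOS : 'cV[R]_n -> R) :
  0 < eps ->
  procedure_AI f g Phi dV du conservative C V u ->
  (fun N => \sum_(0 <= i < N) eps ^+ i * C i) @ \oo --> C_SOS ->
  (forall (x : 'cV[R]_n) (b : 'I_m),
     (fun N => \sum_(1 <= i < N) eps ^+ i * peval (u i b 0) x) @ \oo
       --> u_SOS x b 0) ->
  (forall x : 'cV[R]_n,
     (fun N => \sum_(0 <= i < N) eps ^+ i * peval (V i) x) @ \oo --> V_SOS x) ->
  exists (Q : mpoly n R) (U : 'I_m -> mpoly n R),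
    (forall x b, u_SOS x b 0 = peval (U b) x) /\
    forall x, \sum_a (mxpeval f x + mxpeval g x *m u_SOS x) a 0
                     * peval (mderiv a Q) x
              + peval Phi (col_mx x (u_SOS x)) <= C_SOS.
Proof.
move=> eps0 hAI hC hu hV.
have [[dV0 _] _ hstep] := hAI.
have dVi i : degree_le dV (V i).
  by case: i => [//|i]; have [[]] := hstep i.+1 isT.
have hu' x b : \sum_(0 <= i < N) eps ^+ i * u_val u x b i @[N --> \oo]
    --> u_SOS x b 0.
  by under eq_fun do rewrite u_val_series; apply: hu.
have [Q HQ] := series_bounded_degree dVi hV.
have HU b : exists U, forall x, u_SOS x b 0 = peval U x.
  pose p j : mpoly n R := if j == 0%N then 0 else u j b 0.
  have pE j x : peval (p j) x = u_val u x b j.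
    by rewrite /p /u_val; case: eqP => // _; apply: meval0.
  have dp j : degree_le du (p j).
    case: j => [|j]; first by rewrite /degree_le mmeasure0.
    by have [[_ duj _] _] := hstep j.+1 isT; apply: duj.
  have pL x : \sum_(0 <= i < N) eps ^+ i * peval (p i) x @[N --> \oo]
      --> u_SOS x b 0.
    by under eq_fun do under eq_bigr do rewrite pE; apply: hu'.
  have [U HU] := series_bounded_degree dp pL.
  exists U => x; have := HU (meval (fun a => x a 0)).
  by apply: cvg_unique => //; apply: pL.
have [U UE] := choice HU.
exists Q, U; split => [x b|x]; first exact: UE.
rewrite -subr_le0.
apply: F_limit_le0 eps0 _ hC _ _ => // [i|a].
  exact: F_coef_le0 hAI i x.
exact: (HQ (meval (fun a => x a 0) \o mderiv a)).
Qed.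

(** * Polynomials along trajectories and the averaged inequality *)

Lemma is_derive_peval (R : realType) (n : nat) (x : R -> 'cV[R]_n)
    (t : R) (dx : 'I_n -> R) (p : mpoly n R) :
  (forall a, is_derive t (1 : R) (fun s : R => x s a 0 : R) (dx a)) ->
  is_derive t (1 : R) (fun s : R => peval p (x s) : R)
    (\sum_a dx a * peval (mderiv a p) (x t)).
Proof.
move=> xdx; rewrite /peval.
elim/mpoly_ring_ind: p => [c|b|p q IHp IHq|p q IHp IHq].
- rewrite big1 => [|a _]; last by rewrite mderivC meval0 mulr0.
  by under eq_fun do rewrite mevalC; apply: is_derive_cst.
- have -> : \sum_a dx a * meval (fun a => x t a 0) (mderiv a (mpolyX R (mnm1 b)))
            = dx b.
    rewrite (bigD1 b)//= big1 => [|a ab].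
      rewrite mderivX mnm1E eqxx scale1r addr0.
      by rewrite mevalX big1 ?mulr1// => i _; rewrite mnmE subnn.
    by rewrite mderivX mnm1E eq_sym (negbTE ab) scale0r meval0 mulr0.
  by under eq_fun do rewrite mevalXU; apply: xdx.
- have -> : \sum_a dx a * meval (fun a => x t a 0) (mderiv a (p + q)) =
      \sum_a dx a * meval (fun a => x t a 0) (mderiv a p) +
      \sum_a dx a * meval (fun a => x t a 0) (mderiv a q).
    by rewrite -big_split; apply: eq_bigr => a _; rewrite mderivD mevalD mulrDr.
  by under eq_fun do rewrite mevalD; apply: is_deriveD.
- have -> : \sum_a dx a * meval (fun a => x t a 0) (mderiv a (p * q)) =
      meval (fun a => x t a 0) p *: (\sum_a dx a * meval (fun a => x t a 0) (mderiv a q)) +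
      meval (fun a => x t a 0) q *: (\sum_a dx a * meval (fun a => x t a 0) (mderiv a p)).
    rewrite !scaler_sumr -big_split; apply: eq_bigr => a _.
    rewrite mderivM mevalD !mevalM /GRing.scale /=; ring.
  by under eq_fun do rewrite mevalM; apply: is_deriveM.
Qed.

Lemma peval_bounded (R : realType) (n : nat) (x : R -> 'cV[R]_n) (p : mpoly n R) :
  bounded_trajectory x ->
  exists K : R, forall t, 0 <= t -> `|peval p (x t)| <= K.
Proof.
move=> [M xM]; rewrite /peval.
elim/mpoly_ring_ind: p => [c|a|p q [K1 IH1] [K2 IH2]|p q [K1 IH1] [K2 IH2]].
- by exists `|c| => t _; rewrite mevalC.
- by exists M => t t0; rewrite mevalXU; apply: xM.
- exists (K1 + K2) => t t0; rewrite mevalD (le_trans (ler_normD _ _))//.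
  by rewrite lerD ?IH1 ?IH2.
- by exists (K1 * K2) => t t0; rewrite mevalM normrM ler_pM ?IH1 ?IH2.
Qed.

Lemma within_continuous_peval (R : realType) (k : nat) (A : set R)
    (y : R -> 'I_k -> R) (p : mpoly k R) :
  (forall a, {within A, continuous (fun t => y t a)}) ->
  {within A, continuous (fun t => meval (y t) p)}.
Proof. by move=> yc t; apply: cvg_meval => a; apply: (yc a). Qed.

(** Integrate D + h <= c, where D is the derivative of the storage function W:
    the integral of D is W T - W 0, which is at most 2 K in absolute value. *)
Lemma average_le_of_dissipation (R : realType) (W D h : R -> R) (c K T : R) :
  0 < T ->
  {within `[0, T], continuous W} -> {within `[0, T], continuous D} ->
  {within `[0, T], continuous h} ->
  (forall t : R, 0 < t -> is_derive t (1 : R) W (D t)) ->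
  (forall t : R, 0 <= t -> D t + h t <= c) ->
  (forall t : R, 0 <= t -> `|W t| <= K) ->
  T^-1 * (\int[lebesgue_measure]_(t in `[0, T]) h t)%R <= c + T^-1 * (2 * K).
Proof.
move=> T0 Wc Dc hc WD Dhc WK.
have segI F : {within `[0, T], continuous F} ->
    (@lebesgue_measure R).-integrable `[0, T] (EFin \o F).
  by move=> Fc; apply: continuous_compact_integrable => //; exact: segment_compact.
have cI : (@lebesgue_measure R).-integrable `[0, T] (EFin \o cst c).
  by apply: segI => t; apply: cvg_cst.
have ftc : (\int[lebesgue_measure]_(t in `[0, T]) D t)%R = W T - W 0.
  rewrite /Rintegral (@continuous_FTC2 _ D W) //.
    have /(continuous_within_itvP _ T0)[_ W0 WT] := Wc.
    split => // t; rewrite in_itv /= => /andP[t0 _].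
    by have [] := WD t t0.
  move=> t; rewrite in_itv /= => /andP[t0 _].
  by rewrite derive1E; have [_ ->] := WD t t0.
have le_int : (\int[lebesgue_measure]_(t in `[0, T]) h t)%R <= c * T - (W T - W 0).
  have cT : c * T = (\int[lebesgue_measure]_(t in `[0, T]) (cst c t))%R.
    have mu : (@lebesgue_measure R) [set` `[0, T]] = T%:E.
      by rewrite lebesgue_measure_itv /= lte_fin T0 oppr0 adde0.
    by rewrite Rintegral_cst//; exact: (congr1 (fun z => c * fine z) (esym mu)).
  rewrite -ftc cT -RintegralB//; last exact: segI.
  apply: le_Rintegral => //; first exact: segI.
    apply: (segI (fun t => c - D t)) => t; apply: cvgB; first exact: cvg_cst.
    exact: Dc.
  move=> t; rewrite /= in_itv /= => /andP[t0 _]; rewrite lerBrDl; exact: Dhc.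
have := WK T (ltW T0); have := WK 0 (lexx 0).
move=> /ler_normlP[w1 w2] /ler_normlP[w3 w4].
rewrite mulrC ler_pdivrMr// mulrDl mulrAC mulVf ?gt_eqF// mul1r.
by apply: le_trans le_int _; lra.
Qed.

(** * The bound on the long-time average cost *)

Theorem theorem1 (R : realType) (n m : nat)
    (f : 'cV[mpoly n R]_n) (g : 'M[mpoly n R]_(n, m)) (Phi : mpoly (n + m) R)
    (Phi_ge0 : forall (x : 'cV[R]_n) (v : 'cV[R]_m), 0 <= peval Phi (col_mx x v))
    (dV du : nat) (eps : R) (eps_gt0 : 0 < eps)
    (conservative : nat -> bool)
    (C : nat -> R) (V : nat -> mpoly n R) (u : nat -> 'cV[mpoly n R]_m)
    (hAI : procedure_AI f g Phi dV du conservative C V u)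
    (C_SOS : R) (u_SOS : 'cV[R]_n -> 'cV[R]_m) (V_SOS : 'cV[R]_n -> R)
    (hC : (fun N => \sum_(0 <= i < N) eps ^+ i * C i) @ \oo --> C_SOS)
    (hu : forall (x : 'cV[R]_n) (b : 'I_m),
       (fun N => \sum_(1 <= i < N) eps ^+ i * peval (u i b 0) x) @ \oo
         --> u_SOS x b 0)
    (hV : forall x : 'cV[R]_n,
       (fun N => \sum_(0 <= i < N) eps ^+ i * peval (V i) x) @ \oo --> V_SOS x)
    (hbounded : forall x : R -> 'cV[R]_n,
       closed_loop_trajectory f g u_SOS x -> bounded_trajectory x) :
  forall (x : R -> 'cV[R]_n) (Phi_bar : R),
    closed_loop_trajectory f g u_SOS x ->
    time_average_cost Phi u_SOS x T @[T --> +oo] --> Phi_bar ->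
    Phi_bar <= C_SOS.
Proof.
move=> x Phi_bar xtraj avg.
have [Q [U [UE diss]]] := closed_loop_dissipation eps_gt0 hAI hC hu hV.
have [K QK] := peval_bounded Q (hbounded x xtraj).
have [xc xd] := xtraj.
pose D (t : R) := \sum_a (mxpeval f (x t) + mxpeval g (x t) *m u_SOS (x t)) a 0
                   * peval (mderiv a Q) (x t).
have avg_le (T : R) : 0 < T ->
    time_average_cost Phi u_SOS x T <= C_SOS + T^-1 * (2 * K).
  move=> T0.
  have pc (p : mpoly n R) : {within `[0, T], continuous (fun t => peval p (x t))}.
    apply: within_continuous_peval => a.
    by apply: continuous_subspaceW (xc a) => t; rewrite /= !in_itv /= => /andP[->].
  apply: (@average_le_of_dissipation _ (fun t => peval Q (x t)) D) => //.
  - have -> : D = fun t => \sum_a (peval (f a 0) (x t)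
        + \sum_b peval (g a b) (x t) * peval (U b) (x t)) * peval (mderiv a Q) (x t).
      apply/funext => t; apply: eq_bigr => a _; rewrite !mxE; congr ((_ + _) * _).
      by apply: eq_bigr => b _; rewrite mxE UE.
    move=> t; apply: cvg_bigsum => a; apply: cvgM; last exact: (pc _ t).
    apply: cvgD; first exact: (pc _ t).
    by apply: cvg_bigsum => b; apply: cvgM; exact: (pc _ t).
  - apply: within_continuous_peval => k.
    rewrite (_ : (fun t => _) = fun t => peval
      (match fintype.split k with
       | inl a => mpolyX R (mnm1 a) | inr b => U b end) (x t)); first exact: pc.
    apply/funext => t; rewrite mxE; case: (fintype.split k) => a //.
    by rewrite /peval mevalXU.
  - by move=> t t0; apply: is_derive_peval => a; apply: xd.
  - by move=> t t0; apply: diss.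
apply/ler_addgt0Pr => d d0.
apply: cvgr_to_le avg _; near=> T.
have T0 : 0 < T by near: T; apply: nbhs_pinfty_gt.
apply: le_trans (avg_le T T0) _; rewrite lerD2l mulrC ler_pdivrMr//.
by rewrite -ler_pdivrMl//; near: T; apply: nbhs_pinfty_ge; rewrite num_real.
Unshelve. all: by end_near. Qed.
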